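(* Assume semifilter trichotomy. Then $$\mathsf{U}_{\mathrm{fin}}(\mathcal{O},\Gamma)=\mathsf{S}_{\mathrm{fin}}(\mathcal{O},\mathcal{O})\cap\mathsf{Split}(C_\Omega,C_\Lambda),$$ that is, a separable, zero-dimensional, metrizable space $X$ satisfies $\mathsf{U}_{\mathrm{fin}}(\mathcal{O},\Gamma)$ if and only if it satisfies both $\mathsf{S}_{\mathrm{fin}}(\mathcal{O},\mathcal{O})$ and $\mathsf{Split}(C_\Omega,C_\Lambda)$. In particular, $$\mathsf{U}_{\mathrm{fin}}(\mathcal{O},\Gamma)=\mathsf{S}_{\mathrm{fin}}(\mathcal{O},\mathcal{O})\cap\mathsf{Split}(\Omega,\Lambda),$$ that is, a separable, zero-dimensional, metrizable space $X$ satisfies $\mathsf{U}_{\mathrm{fin}}(\mathcal{O},\Gamma)$ if and only if it satisfies both $\mathsf{S}_{\mathrm{fin}}(\mathcal{O},\mathcal{O})$ and $\mathsf{Split}(\Omega,\Lambda)$.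
   Context: Spaces. All spaces are separable, zero-dimensional, and metrizable. An equality between covering properties means that exactly the same spaces satisfy both sides; an intersection of properties means satisfying all of them. Covers. Let $\mathcal{U}$ be an open cover of a space $X$. $\mathcal{U}$ is large if each $x\in X$ is contained in infinitely many members of $\mathcal{U}$. $\mathcal{U}$ is an $\omega$-cover if $X\notin\mathcal{U}$ and each finite $F\subseteq X$ is contained in some $U\in\mathcal{U}$. $\mathcal{U}$ is a $\gamma$-cover if it is infinite and each $x\in X$ belongs to all but finitely many members of $\mathcal{U}$. $\mathcal{O},\Lambda,\Omega,\Gamma$ denote the collections of all countable open covers, large open covers, open $\omega$-covers, and open $\gamma$-covers of $X$, respectively. $C_\Lambda, C_\Omega$ denote the collections of all countable large covers and countable $\omega$-covers of $X$, respectively, consisting of clopen sets. Properties of $X$, for families of covers $\mathscr{A},\mathscr{B}$: - $\mathsf{S}_{\mathrm{fin}}(\mathscr{A},\mathscr{B})$: for each sequence $(\mathcal{U}_n)_{n\in\mathbb{N}}$ of members of $\mathscr{A}$ there are finite $\mathcal{F}_n\subseteq\mathcal{U}_n$ with $\bigcup_n\mathcal{F}_n\in\mathscr{B}$. - $\mathsf{U}_{\mathrm{fin}}(\mathscr{A},\mathscr{B})$: for each sequence $(\mathcal{U}_n)_{n\in\mathbb{N}}$ of members of $\mathscr{A}$ which do not contain a finite subcover, there are finite $\mathcal{F}_n\subseteq\mathcal{U}_n$ with $\{\bigcup\mathcal{F}_n : n\in\mathbb{N}\}\in\mathscr{B}$. - $\mathsf{Split}(\mathscr{A},\mathscr{B})$: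 every $\mathcal{U}\in\mathscr{A}$ can be split into two disjoint subcovers $\mathcal{V}$ and $\mathcal{W}$, each containing an element of $\mathscr{B}$. Semifilter trichotomy. $[\mathbb{N}]^{\aleph_0}$ is the set of infinite subsets of $\mathbb{N}=\{0,1,2,\dots\}$. For $a,b\in[\mathbb{N}]^{\aleph_0}$, $a\subseteq^* b$ means $a\setminus b$ is finite. A semifilter is a nonempty $F\subseteq[\mathbb{N}]^{\aleph_0}$ such that $a\in F$, $b\in[\mathbb{N}]^{\aleph_0}$ and $a\subseteq^* b$ imply $b\in F$. A filter is a semifilter closed under finite intersections (ultrafilters here are accordingly nonprincipal). The Fréchet filter is the set of all cofinite subsets of $\mathbb{N}$. For $a\in[\mathbb{N}]^{\aleph_0}$ and a (strictly) increasing $h\in\mathbb{N}^{\mathbb{N}}$, $a/h=\{n : a\cap[h(n),h(n+1))\neq\emptyset\}$, and $S/h=\{a/h : a\in S\}$ for $S\subseteq[\mathbb{N}]^{\aleph_0}$. Semifilter trichotomy is the statement: for each semifilter $S$ there is an increasing $h\in\mathbb{N}^{\mathbb{N}}$ such that $S/h$ is either the Fréchet filter, or an ultrafilter, or $[\mathbb{N}]^{\aleph_0}$. *)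

(* Defs.v *)
From mathcomp Require Import all_boot all_order all_algebra.
From mathcomp Require Import all_classical all_reals topology.

Set Implicit Arguments.
Unset Strict Implicit.
Unset Printing Implicit Defensive.

Import Order.TTheory GRing.Theory Num.Theory.

Local Open Scope classical_set_scope.

Section Spaces.
Context (T : topologicalType).

Definition separable : Prop := exists2 D : set T, countable D & dense D.

(* Small inductive dimension zero: the clopen sets form a base.  The library's
   [zero_dimensional] only asks that clopen sets separate points, which is
   weaker for non-compact spaces.  The empty space is allowed. *)
Definition clopen_based : Prop := basis (@clopen T).

Definition metrizable (R : realType) : Prop :=
  exists d : T -> T -> R,
    [/\ forall x y, (d x y = 0%R) <-> (x = y),
        forall x y, d x y = d y x,
        forall x y z, (d x z <= d x y + d y z)%R
      & forall (x : T) (A : set T), nbhs x A <->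
          exists2 e : R, (0 < e)%R & [set y | (d x y < e)%R] `<=` A].

End Spaces.

Section Covers.
Context (T : topologicalType).
Implicit Types (U : set (set T)) (AA BB : set (set (set T))).

Definition covers U : Prop := \bigcup_(A in U) A = setT.

Definition large U : Prop :=
  forall x : T, infinite_set [set A | U A /\ A x].

Definition omega_cover U : Prop :=
  ~ U setT /\
  forall F : set T, finite_set F -> exists2 A, U A & F `<=` A.

Definition gamma_cover U : Prop :=
  infinite_set U /\ forall x : T, finite_set [set A | U A /\ ~ A x].

Definition Open : set (set (set T)) :=
  [set U | [/\ countable U, U `<=` @open T & covers U]].

Definition Lambda : set (set (set T)) := [set U | Open U /\ large U].

Definition Omega : set (set (set T)) := [set U | Open U /\ omega_cover U].

Definition Gamma : set (set (set T)) := [set U | Open U /\ gamma_cover U].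

Definition CLambda : set (set (set T)) :=
  [set U | Lambda U /\ U `<=` @clopen T].

Definition COmega : set (set (set T)) :=
  [set U | Omega U /\ U `<=` @clopen T].

Definition Sfin AA BB : Prop :=
  forall U : nat -> set (set T), (forall n, AA (U n)) ->
  exists2 F : nat -> set (set T),
    forall n, finite_set (F n) /\ F n `<=` U n & BB (\bigcup_n F n).

Definition has_finite_subcover U : Prop :=
  exists F : set (set T), [/\ finite_set F, F `<=` U & covers F].

Definition Ufin AA BB : Prop :=
  forall U : nat -> set (set T),
  (forall n, AA (U n) /\ ~ has_finite_subcover (U n)) ->
  exists2 F : nat -> set (set T),
    forall n, finite_set (F n) /\ F n `<=` U n &
    BB (range (fun n => \bigcup_(A in F n) A)).

Definition Splitting AA BB : Prop :=
  forall U, AA U ->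
  exists V W : set (set T),
    [/\ V `|` W = U, V `&` W = set0, covers V /\ covers W,
        exists2 V', V' `<=` V & BB V' & exists2 W', W' `<=` W & BB W'].

End Covers.

Arguments Open T : clear implicits.
Arguments Lambda T : clear implicits.
Arguments Omega T : clear implicits.
Arguments Gamma T : clear implicits.
Arguments CLambda T : clear implicits.
Arguments COmega T : clear implicits.

Section Semifilters.
Implicit Types (a b : set nat) (S F : set (set nat)) (h : nat -> nat).

Definition almost_subset a b : Prop := finite_set (a `\` b).

Definition semifilter S : Prop :=
  [/\ S !=set0, forall a, S a -> infinite_set a
    & forall a b, S a -> infinite_set b -> almost_subset a b -> S b].

Definition filter_semifilter F : Prop :=
  semifilter F /\ forall a b, F a -> F b -> F (a `&` b).

(* A semifilter consists of infinite sets, so such an ultrafilter is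
   nonprincipal. *)
Definition ultrafilter_semifilter F : Prop :=
  filter_semifilter F /\ UltraFilter F.

Definition frechet : set (set nat) := [set a | cofinite_set a].

Definition quot h a : set nat :=
  [set n | a `&` [set k | (h n <= k < h n.+1)%N] !=set0].

Definition semifilter_trichotomy : Prop :=
  forall S, semifilter S ->
  exists2 h : nat -> nat, {homo h : m n / (m < n)%N} &
    [\/ quot h @` S = frechet,
        ultrafilter_semifilter (quot h @` S)
      | quot h @` S = [set a | infinite_set a]].

End Semifilters.

(* Main.v *)
Require Import Defs.
From mathcomp Require Import all_boot all_order all_algebra.
From mathcomp Require Import all_classical all_reals topology.
From mathcomp Require Import zify.

(** A sequence [V] of subsets of [X] sends each point [x] to its trace, the set
    of indices [i] with [V i x].  All the covering properties of the theorem
    are compared with one statement about traces: whenever every trace is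
    infinite, there is an increasing [h] such that every trace meets all but
    finitely many of the blocks of integers from [h k] (included) to [h k.+1]
    (excluded); this conclusion is [meets_blocks V].

    The Hurewicz property Ufin(O,Gamma) gives this for open sequences
    ([ufin_Gamma_meets_blocks]), by selecting from the covers formed by the
    tails of [V].  Number an omega-cover, which is automatically large, and put
    the members with index in an even block on one side and the rest on the
    other: every point meets almost every block, so both sides are large, which
    is Split(Omega,Lambda).

    Conversely, the statement for clopen sequences gives back Ufin(O,Gamma)
    ([refining_ufin_Gamma]).  In a separable metrizable space with a clopen base
    every open cover has a countable clopen refinement; the least indices at
    which [x] enters the refinements form a function [nat -> nat], which is
    coded by the range of a strictly increasing function above it.  A range
    meeting almost all blocks of [h] bounds that function in terms of [h]
    alone, and a bound common to all [x] gives the finite selections.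

    It remains to obtain the statement for clopen sequences from
    Sfin(O,O), Split(COmega,CLambda) and the trichotomy
    ([trichotomy_meets_blocks]).  Apply the trichotomy to the semifilter
    generated by the traces, so that [h] is given.
    - If the quotient is the Frechet filter, the statement holds as is.
    - If it consists of all infinite sets, every infinite set almost contains a
      quotient trace, so that the enumerations of these traces dominate every
      function; the Menger property Sfin(O,O) forbids this
      ([menger_not_dominated]).
    - If it is an ultrafilter, the quotient traces form a base of it, so the
      unions of [V] over the blocks form a clopen omega-cover, unless some of
      them are the whole space.  One half of any splitting of that cover
      corresponds to a set of the ultrafilter, hence almost contains some
      quotient trace; that point is then in only finitely many sets of the other
      half, which cannot contain a large cover
      ([Splitting_ultrafilter_full_blocks]).  So infinitely many unions are the whole
      space, and merging blocks finishes the proof. *)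

Set Implicit Arguments.
Unset Strict Implicit.
Unset Printing Implicit Defensive.

Import Order.TTheory GRing.Theory Num.Theory.

Local Open Scope classical_set_scope.

(** * Infinite sets of integers and their block quotients *)

Lemma finite_natP (A : set nat) :
  finite_set A <-> exists N, forall n, A n -> n < N.
Proof.
split=> [/finite_seqP[s ->]|[N AN]].
  exists (\max_(i <- s) i).+1 => n /= ns.
  by rewrite ltnS; exact: (@leq_bigmax_seq _ _ xpredT id n).
by apply: (sub_finite_set _ (finite_II N)) => n /AN.
Qed.

Lemma cofinite_natP (A : set nat) :
  cofinite_set A <-> exists N, forall n, N <= n -> A n.
Proof.
split=> [/finite_natP[N AN]|[N AN]].
  by exists N => n Nn; apply: contrapT => /AN; rewrite ltnNge Nn.
apply/finite_natP; exists N => n nAn; rewrite ltnNge; apply/negP => /AN.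
exact: nAn.
Qed.

Lemma infinite_natP (A : set nat) :
  infinite_set A <-> forall N, exists2 n, N <= n & A n.
Proof.
split=> [Ainf N|Aunb /finite_natP[N AN]].
  apply: contrapT => noN; apply/Ainf/finite_natP; exists N => n An.
  by rewrite ltnNge; apply/negP => Nn; apply: noN; exists n.
by have [n Nn /AN] := Aunb N; rewrite ltnNge Nn.
Qed.

Lemma infinite_injected T (A : set T) (f : T -> nat) :
  (forall N, exists2 a, A a & N <= f a) -> infinite_set A.
Proof.
move=> Aunb Afin; have /finite_natP[N fN] := finite_image f Afin.
have [a Aa Nfa] := Aunb N.
by have := fN (f a) (imageP f Aa); rewrite ltnNge Nfa.
Qed.

Lemma finite_sub_range T (p : nat -> T) (F : set T) :
  finite_set F -> F `<=` range p -> exists N, F `<=` p @` `I_N.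
Proof.
move=> Ffin Fp.
have /choice[g gP] : forall A, exists m, F A -> p m = A.
  move=> A; case: (pselect (F A)) => [/Fp[m _ pm]|nFA]; first by exists m.
  by exists 0 => /nFA.
have /finite_natP[N gN] := finite_image g Ffin.
by exists N => A FA; exists (g A); [apply: gN; exists A|apply: gP].
Qed.

Lemma iter_increasing (f : nat -> nat) n0 : (forall n, n < f n) ->
  {homo (fun k => iter k f n0) : m n / (m < n)%N}.
Proof.
move=> fgt m n; elim: n => // n IH; rewrite ltnS leq_eqVlt => /orP[/eqP->|/IH].
  exact: fgt.
by move=> /ltn_trans; apply; exact: fgt.
Qed.

Lemma increasing_ge (h : nat -> nat) : {homo h : m n / (m < n)%N} ->
  forall k, k <= h k.
Proof. by move=> hh; elim=> // k IH; apply: leq_ltn_trans IH _; exact: hh. Qed.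

Lemma increasing_homo_le (h : nat -> nat) : {homo h : m n / (m < n)%N} ->
  {homo h : m n / (m <= n)%N}.
Proof.
by move=> hh m n; rewrite leq_eqVlt => /orP[/eqP->//|/hh/ltnW].
Qed.

Lemma infinite_enum (A : set nat) : infinite_set A ->
  exists2 s : nat -> nat, {homo s : m n / (m < n)%N} & forall k, A (s k).
Proof.
move=> /infinite_natP Ainf.
have /choice[f fP] : forall n, exists m, n < m /\ A m.
  by move=> n; have [m nm Am] := Ainf n.+1; exists m.
exists (fun k => iter k f (f 0)); last by case=> [|k]; apply: (fP _).2.
by apply: iter_increasing => n; case: (fP n).
Qed.

Lemma block_leq (h : nat -> nat) k l i : {homo h : m n / (m < n)%N} ->
  h k <= i -> i < h l.+1 -> k <= l.
Proof.
move=> hh ki il; rewrite leqNgt; apply/negP => lk.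
have := increasing_homo_le hh lk; lia.
Qed.

Lemma quot_almost_subset (h : nat -> nat) (a b : set nat) :
  {homo h : m n / (m < n)%N} ->
  almost_subset a b -> almost_subset (quot h a) (quot h b).
Proof.
move=> hh /finite_natP[N abN]; apply/finite_natP; exists N => k [].
move=> [i [ai /= hki]] nb; apply: leq_ltn_trans (increasing_ge hh k) _.
case/andP: (hki) => hk _.
apply: leq_ltn_trans hk (abN i _); split=> // bi; apply: nb.
by exists i.
Qed.

(** Merging consecutive blocks turns an infinite set of blocks that are all met
    into the set of all blocks, since each merged block contains one of them. *)
Lemma quot_coarsen (h s : nat -> nat) (a : set nat) :
  {homo h : m n / (m < n)%N} -> {homo s : m n / (m < n)%N} ->
  (forall k, quot h a (s k)) -> quot (h \o s) a = setT.
Proof.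
move=> hh hs ha; apply/seteqP; split=> // k _.
have [i [ai /andP[ki ik]]] := ha k.
exists i; split=> //=; rewrite ki /=.
by apply: leq_trans ik _; apply: increasing_homo_le hh _ _ _; apply: hs.
Qed.

(** From some point on every block contains a value of [g], so among the blocks
    up to number [N + n] there are more than [n] of these values; as [g] is
    increasing, its value at [n] lies below the end of that block.  The index
    [n.*2.+1] absorbs [N], which makes the bound depend on [h] only. *)
Lemma quot_range_bound (h g : nat -> nat) :
  {homo h : m n / (m < n)%N} -> {homo g : m n / (m < n)%N} ->
  cofinite_set (quot h (range g)) ->
  exists N, forall n, N <= n -> g n < h n.*2.+1.
Proof.
move=> hh hg /cofinite_natP[N NP].
have step n : exists2 m, n <= m & g m < h (N + n).+1.
  elim: n => [|n [m nm gm]].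
    by have [|_ [[m _ <-] /andP[_ gm]]] := NP (N + 0); [lia|exists m].
  have [|_ [[m' _ <-] /andP[hm' gm']]] := NP (N + n.+1); first by lia.
  exists m' => //; apply: leq_ltn_trans nm _; rewrite ltnNge; apply/negP.
  move=> /(increasing_homo_le hg); rewrite addnS in hm'; lia.
exists N => n Nn; have [m nm gm] := step n.
apply: leq_ltn_trans (increasing_homo_le hg nm) (leq_trans gm _).
by apply: increasing_homo_le hh _ _ _; lia.
Qed.

(** The successor makes this strictly increasing even where [f] vanishes, so
    that its range is infinite and determines it. *)
Fixpoint gapped_sums (f : nat -> nat) n :=
  if n is k.+1 then (gapped_sums f k + f k.+1).+1 else f 0.

Lemma gapped_sums_ge f n : f n <= gapped_sums f n.
Proof. by case: n => [|n] //=; lia. Qed.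

Lemma gapped_sums_increasing f : {homo gapped_sums f : m n / (m < n)%N}.
Proof.
move=> m n; elim: n => // n IH; rewrite ltnS leq_eqVlt => /orP[/eqP->|/IH] /=; lia.
Qed.

(** * Bounds from the Menger property *)

Section Covers.
Context (X : topologicalType).
Implicit Types (V : nat -> set X) (P : nat -> nat -> set X).

Definition meets_blocks V : Prop :=
  exists2 h : nat -> nat, {homo h : m n / (m < n)%N} &
    forall x, cofinite_set (quot h [set i | V i x]).

Lemma Open_range (p : nat -> set X) : (forall m, open (p m)) ->
  (forall x, exists m, p m x) -> Open X (range p).
Proof.
move=> po pc; split; first exact: card_image_le.
  by move=> _ [m _ <-].
apply/seteqP; split=> // x _; have [m pmx] := pc x.
by exists (p m) => //; exists m.
Qed.

(** The Menger property in the form used below: the covers are given with an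
    enumeration, and a finite selection becomes a bound on the index. *)
Lemma menger_bound P : Sfin (Open X) (Open X) ->
  (forall n m, open (P n m)) -> (forall n x, exists m, P n m x) ->
  exists b : nat -> nat, forall x, exists n, exists2 m, m < b n & P n m x.
Proof.
move=> menger Po Pc.
have [F Ffin [_ _ Fcov]] := menger _ (fun n => Open_range (Po n) (Pc n)).
have /choice[b bP] : forall n, exists N, F n `<=` P n @` `I_N.
  by move=> n; have [fin sub] := Ffin n; exact: finite_sub_range.
exists b => x; have : [set: X] x by [].
rewrite -Fcov => -[A [n _ /bP[m /= mb <-]] Px].
by exists n, m.
Qed.

(** Selecting separately from each tail of the sequence of covers makes the
    bound effective at infinitely many places for every point. *)
Lemma menger_frequent_bound P : Sfin (Open X) (Open X) ->
  (forall n m, open (P n m)) -> (forall n x, exists m, P n m x) ->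
  exists b : nat -> nat, forall x N,
    exists2 n, N <= n & exists2 m, m < b n & P n m x.
Proof.
move=> menger Po Pc.
have /choice[b bP] : forall N, exists b : nat -> nat, forall x,
    exists n, exists2 m, m < b n & P (N + n) m x.
  by move=> N; apply: menger_bound.
exists (fun n => \sum_(N < n.+1) b N (n - N)) => x N.
have [n [m mb Px]] := bP N x.
exists (N + n); first exact: leq_addr.
exists m => //; apply: leq_trans mb _.
have NN : N < (N + n).+1 by rewrite ltnS leq_addr.
rewrite (bigD1 (Ordinal NN)) //= addKn; exact: leq_addr.
Qed.

(** Two members of the trace are caught between [n] and [b n] for infinitely
    many [n], while [c] is chosen so sparse that there is at most one
    element of it between [n] and [b n].  Catching a single member would not suffice, as this
    member could belong to [c]. *)
Lemma menger_not_dominated V : Sfin (Open X) (Open X) ->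
  (forall i, open (V i)) -> (forall x, infinite_set [set i | V i x]) ->
  exists2 c : set nat, infinite_set c &
    forall x, ~ almost_subset [set i | V i x] c.
Proof.
move=> menger Vo Vinf.
pose P n m := [set x | exists i j, [/\ n <= i, i < j, j <= m, V i x & V j x]].
have Po n m : open (P n m).
  rewrite (_ : P n m = \bigcup_(i in [set i | n <= i])
      \bigcup_(j in [set j | i < j <= m]) (V i `&` V j)).
    by apply: bigcup_open => i _; apply: bigcup_open => j _; apply: openI.
  apply/seteqP; split=> x.
    move=> [i [j [ni ij jm Vi Vj]]].
    by exists i => //; exists j => //=; apply/andP.
  by move=> [i ni [j /andP[ij jm] [Vi Vj]]]; exists i, j.
have Pc n x : exists m, P n m x.
  have /infinite_natP Vx := Vinf x.
  have [i ni Vi] := Vx n; have [j ij Vj] := Vx i.+1.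
  by exists j, i, j.
have [b bP] := menger_frequent_bound menger Po Pc.
pose B n := \sum_(i < n.+1) b i.
have Bb n l : n <= l -> b n <= B l.
  move=> nl; have nl' : n < l.+1 by [].
  rewrite /B (bigD1 (Ordinal nl')) //=; exact: leq_addr.
pose f n := maxn n.+1 (B n).
have fgt n : n < f n by rewrite /f leq_max leqnn.
have hs := iter_increasing 0 fgt.
(* The next element of [c] after [e] is at least [b n] for every [n <= e]. *)
exists (range (fun k => iter k f 0)).
  apply/infinite_natP => N; exists (iter N f 0); first exact: increasing_ge.
  by exists N.
move=> x /finite_natP[N xN].
have [n Nn [m mb [i [j [ni ij jm Vi Vj]]]]] := bP x N.
have ci : range (fun k => iter k f 0) i.
  apply: contrapT => nci; have := xN i (conj Vi nci); lia.
have cj : range (fun k => iter k f 0) j.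
  apply: contrapT => ncj; have := xN j (conj Vj ncj); lia.
case: ci cj => k _ ki [l _ lj].
have kl : k < l.
  by rewrite ltnNge; apply/negP => /(increasing_homo_le hs); lia.
have := increasing_homo_le hs kl; rewrite /= ki lj /f.
have := Bb n i ni; lia.
Qed.

(** * Blocks and splittings from the Hurewicz property *)

(** A gamma-cover is a set, so the selected unions [G n] may repeat, and a
    point could be missed by one value [G n] for infinitely many [n].  Keeping only
    the first occurrence of each value ([D]) makes [G] injective there, so
    that a point is missed only finitely often on [D]; [D] is infinite as a gamma-cover is.
    The antitonicity of [P] in its first argument transfers the bound from an
    index [s n] in [D] to every smaller index [n]. *)
Lemma ufin_Gamma_bound P : Ufin (Open X) (Gamma X) ->
  (forall n m, open (P n m)) -> (forall n x, exists m, P n m x) ->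
  (forall k n m, k <= n -> P n m `<=` P k m) ->
  exists b : nat -> nat, forall x,
    exists N, forall n, N <= n -> exists2 m, m < b n & P n m x.
Proof.
move=> hurewicz Po Pc Pmono.
(* Ufin says nothing about covers with a finite subcover.  These give a
   bound directly when they occur at every [n]; by antitonicity, if some
   [n0] has none then neither has any later index. *)
have [nofin|] := pselect (exists n0, ~ has_finite_subcover (range (P n0)));
    last first.
  move=> /forallNP allfin.
  have /choice[b bP] : forall n, exists N, forall x,
      exists2 m, m < N & P n m x.
    move=> n; have [F [Ffin Fsub Fcov]] := contrapT (allfin n).
    have [N FN] := finite_sub_range Ffin Fsub.
    exists N => x; have : [set: X] x by [].
    by rewrite -Fcov => -[A /FN[m mN <-] Px]; exists m.
  by exists b => x; exists 0 => n _; apply: bP.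
have [n0 nofin0] := nofin.
have nofinD n : ~ has_finite_subcover (range (P (n0 + n))).
  move=> [F [Ffin Fsub Fcov]]; apply: nofin0.
  have [N FN] := finite_sub_range Ffin Fsub.
  exists (P n0 @` `I_N); split.
  - exact: finite_image (finite_II _).
  - by move=> _ [m _ <-]; exists m.
  apply/seteqP; split=> // x _; have : [set: X] x by [].
  rewrite -Fcov => -[A /FN[m mN <-] Px].
  by exists (P n0 m); [exists m|apply: Pmono Px; exact: leq_addr].
have [|F Ffin [_ [Ginf Gfin]]] := hurewicz (fun n => range (P (n0 + n))).
  by move=> n; split=> //; apply: Open_range.
set G := (fun n => _) in Ginf Gfin.
pose D := [set n | forall j, j < n -> G j <> G n].
have Dinf : infinite_set D.
  move=> Dfin; apply/Ginf/(sub_finite_set _ (finite_image G Dfin)).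
  move=> _ [n _ <-].
  have ex : exists i, `[< G i = G n >] by exists n; apply/asboolP.
  case: (ex_minnP ex) => i /asboolP Gi imin.
  exists i => // j ji Gj; have : i <= j by apply: imin; apply/asboolP; rewrite Gj.
  by rewrite leqNgt ji.
have /choice[s sP] : forall k, exists n, k <= n /\ D n.
  by move=> k; have /infinite_natP/(_ k)[n kn Dn] := Dinf; exists n.
have /choice[b bP] : forall n, exists N, F n `<=` P (n0 + n) @` `I_N.
  by move=> n; have [fin sub] := Ffin n; exact: finite_sub_range.
have Dinj : {in D &, injective G}.
  move=> i j /set_mem Di /set_mem Dj Gij.
  by case: (ltngtP i j) => // ij; [case: (Dj i ij)|case: (Di j ij)].
exists (fun n => b (s n)) => x.
have : finite_set (D `&` [set n | ~ G n x]).
  have Dinj' : {in D `&` [set n | ~ G n x] &, injective G}.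
    by move=> i j /set_mem[Di _] /set_mem[Dj _]; apply: Dinj; exact/mem_set.
  rewrite -(eq_finite_set (inj_card_eq Dinj')).
  by apply: sub_finite_set (Gfin x) => _ [n [_ nG] <-]; split=> //; exists n.
move=> /finite_natP[N DN]; exists N => n Nn.
have [ns Dn] := sP n.
have : G (s n) x.
  by apply: contrapT => nG; have := DN _ (conj Dn nG); lia.
move=> [A /bP[m mb <-] Px]; exists m => //; apply: Pmono Px; lia.
Qed.

(** With [P n m] standing for [V m] when [n <= m], the bound [b] says that the
    trace of a point has an element from [n] to [b n] for almost all [n];
    iterating [b] turns these intervals into consecutive blocks. *)
Lemma ufin_Gamma_meets_blocks V : Ufin (Open X) (Gamma X) ->
  (forall i, open (V i)) -> (forall x, infinite_set [set i | V i x]) ->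
  meets_blocks V.
Proof.
move=> hurewicz Vo Vinf.
pose P n m := [set x | n <= m /\ V m x].
have Po n m : open (P n m).
  case: (leqP n m) => nm.
    by rewrite (_ : P n m = V m) //; apply/seteqP; split=> x // [].
  rewrite (_ : P n m = set0); first exact: open0.
  by apply/seteqP; split=> x // []; rewrite leqNgt nm.
have Pc n x : exists m, P n m x.
  by have /infinite_natP/(_ n)[m nm Vm] := Vinf x; exists m.
have Pmono k n m : k <= n -> P n m `<=` P k m.
  by move=> kn x [nm Vm]; split=> //; apply: leq_trans nm.
have [b bP] := ufin_Gamma_bound hurewicz Po Pc Pmono.
pose f n := maxn n.+1 (b n).
have fgt n : n < f n by rewrite /f leq_max leqnn.
have hh := iter_increasing 0 fgt.
exists (fun k => iter k f 0) => // x; apply/cofinite_natP.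
have [N NP] := bP x; exists N => k Nk.
have [|m mb [km Vm]] := NP (iter k f 0).
  exact: leq_trans Nk (increasing_ge hh k).
exists m; split=> //=; rewrite km /=.
by apply: leq_trans mb _; rewrite /f leq_max leqnn orbT.
Qed.

Lemma ufin_Gamma_Sfin : Ufin (Open X) (Gamma X) -> Sfin (Open X) (Open X).
Proof.
move=> hurewicz U UO.
suff [F Ffin Fcov] : exists2 F : nat -> set (set X),
    forall n, finite_set (F n) /\ F n `<=` U n & covers (\bigcup_n F n).
  exists F => //; split=> //.
    by apply: bigcup_countable => // n _; apply: finite_set_countable; case: (Ffin n).
  by move=> A [n _ FA]; have [_ Uo _] := UO n; apply: Uo; apply: (Ffin n).2.
have [[n0 [F [Ffin Fsub Fcov]]]|/forallNP nofin] :=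
    pselect (exists n, has_finite_subcover (U n)).
  exists (fun n => if n == n0 then F else set0).
  by move=> n; case: eqVneq => [->|_] /=; [split|split; [exact: finite_set0|]].
  apply/seteqP; split=> // x _; have : [set: X] x by [].
  by rewrite -Fcov => -[A FA Ax]; exists A => //; exists n0; rewrite ?eqxx.
have [|F Ffin [[_ _ Fcov] _]] := hurewicz U; first by split; [exact: UO|exact: nofin].
exists F => //; apply/seteqP; split=> // x _; have : [set: X] x by [].
rewrite -Fcov => -[_ [n _ <-] [A FA Ax]].
by exists A => //; exists n.
Qed.

(** If only finitely many members contained [x], then [x] together with one
    point outside each of them would be a finite set in no member. *)
Lemma omega_cover_large (U : set (set X)) : omega_cover U -> large U.
Proof.
move=> [UT Ufin] x Uxfin.
have /choice[y yP] : forall A, exists y, U A -> ~ A y.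
  move=> A; apply: contrapT => /forallNP Ay; apply: UT.
  have UA : U A by apply: contrapT => nUA; apply: (Ay x).
  suff <- : A = setT by [].
  apply/seteqP; split=> // z _; apply: contrapT => nAz; exact: (Ay z).
have [|A UA FA] := Ufin (x |` y @` [set A | U A /\ A x]).
  by rewrite finite_setU; split; [exact: finite_set1|exact: finite_image].
by apply: (yP A UA); apply: (FA); right; exists A => //; split=> //; apply: FA; left.
Qed.

Lemma Lambda_sub (U V : set (set X)) : Open X U -> V `<=` U -> large V ->
  Lambda X V.
Proof.
move=> [Uc Uo _] VU Vlarge; split=> //; split.
- exact: sub_countable (subset_card_le VU) Uc.
- by move=> A /VU /Uo.
apply/seteqP; split=> // x _.
by have /infinite_setN0[A [VA Ax]] := Vlarge x; exists A.
Qed.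

Lemma Lambda_covers (U : set (set X)) : Lambda X U -> covers U.
Proof. by move=> [[]]. Qed.

(** The members of the cover are numbered by an injection [f], and [E] collects
    those whose number falls in an even block.  Every point meets almost all
    blocks, hence infinitely many of each parity. *)
Lemma ufin_Gamma_Splitting : Ufin (Open X) (Gamma X) ->
  Splitting (Omega X) (Lambda X).
Proof.
move=> hurewicz U [UO /omega_cover_large Ularge].
have [Uc Uo _] := UO; have /countable_injP[f finj] := Uc.
(* [V i] is the member of number [i], or empty when there is none. *)
pose V i := \bigcup_(A in [set A | U A /\ f A = i]) A.
have Vo i : open (V i) by apply: bigcup_open => A [/Uo].
have Vinf x : infinite_set [set i | V i x].
  have finj' : {in [set A | U A /\ A x] &, injective f}.
    by move=> A B /set_mem[UA _] /set_mem[UB _]; apply: finj; exact/mem_set.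
  move=> Vfin; apply: (Ularge x).
  rewrite -(eq_finite_set (inj_card_eq finj')).
  by apply: sub_finite_set Vfin => _ [A [UA Ax] <-]; exists A.
have [h hh hP] := ufin_Gamma_meets_blocks hurewicz Vo Vinf.
have blockP x N (p : bool) : exists A k, [/\ U A, A x, N <= f A, odd k = p
    & h k <= f A < h k.+1].
  have /cofinite_natP[M MP] := hP x.
  pose k := (M + N).*2 + p.
  have [|i [/= [A [UA <-] Ax] hki]] := MP k; first by rewrite /k; lia.
  exists A, k; split=> //; last by rewrite /k oddD odd_double oddb.
  have := increasing_ge hh k; rewrite /k in hki *; lia.
pose E := [set A | U A /\ exists k, ~~ odd k /\ h k <= f A < h k.+1].
have EU : E `<=` U by move=> A [].
have Elarge : large E.
  move=> x; apply: (@infinite_injected _ _ f) => N.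
  have [A [k [UA Ax NA kodd hk]]] := blockP x N false.
  by exists A => //; split=> //; split=> //; exists k; rewrite kodd.
have Dlarge : large (U `\` E).
  move=> x; apply: (@infinite_injected _ _ f) => N.
  have [A [k [UA Ax NA kodd /andP[hk hk1]]]] := blockP x N true.
  exists A => //; split=> //; split=> // -[_ [l [lodd /andP[hl hl1]]]].
  have kl : k = l.
    by apply/eqP; rewrite eqn_leq (block_leq hh hk hl1) (block_leq hh hl hk1).
  by rewrite -kl kodd in lodd.
have EL : Lambda X E := Lambda_sub UO EU Elarge.
have DL : Lambda X (U `\` E) := Lambda_sub UO (@subDsetl _ _ _) Dlarge.
exists E, (U `\` E); split.
- by rewrite setDUK.
- by rewrite setDIK.
- by split; exact: Lambda_covers.
- by exists E.
- by exists (U `\` E).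
Qed.

Lemma Splitting_clopen : Splitting (Omega X) (Lambda X) ->
  Splitting (COmega X) (CLambda X).
Proof.
move=> split U [UO Uclopen].
have [V [W [VWU VW0 covVW [V' V'V V'L] [W' W'W W'L]]]] := split U UO.
exists V, W; split=> //.
  by exists V' => //; split=> // A /V'V VA; apply: Uclopen; rewrite -VWU; left.
by exists W' => //; split=> // A /W'W WA; apply: Uclopen; rewrite -VWU; right.
Qed.

(** * Blocks from the trichotomy *)

Lemma clopen_bigcup (I : choiceType) (D : set I) (V : I -> set X) :
  finite_set D -> (forall i, D i -> clopen (V i)) ->
  clopen (\bigcup_(i in D) V i).
Proof.
move=> Dfin Vc; split; first by apply: bigcup_open => i /Vc[].
by apply: closed_bigcup => // i /Vc[].
Qed.

(** If only finitely many of the block unions [W k] were the whole space, the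
    others would form a clopen omega-cover, because the quotient traces of
    finitely many points intersect in a set of [F], hence in infinitely many
    indices.  The two halves of its splitting correspond to two sets of indices,
    one of which is in [F] and almost contains a quotient trace; that trace
    meets the other one in a finite set. *)
Lemma Splitting_ultrafilter_full_blocks V (h : nat -> nat) (F : set (set nat)) :
  Splitting (COmega X) (CLambda X) ->
  (forall i, clopen (V i)) -> {homo h : m n / (m < n)%N} ->
  ultrafilter_semifilter F ->
  (forall x, F (quot h [set i | V i x])) ->
  (forall A, F A -> exists x, almost_subset (quot h [set i | V i x]) A) ->
  exists2 s : nat -> nat, {homo s : m n / (m < n)%N} &
    forall k x, quot h [set i | V i x] (s k).
Proof.
move=> splitting Vc hh [[[[F0 FA0] Finf Fup] FI] Fultra] Fx Fbase.
pose W k := [set x | quot h [set i | V i x] k].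
have Wc k : clopen (W k).
  rewrite (_ : W k = \bigcup_(i in [set i | h k <= i < h k.+1]) V i).
    apply: clopen_bigcup => //; apply/finite_natP.
    by exists (h k.+1) => n /andP[].
  by apply/seteqP; split=> x [i]; [case=> ? ?|move=> ? ?]; exists i.
(* An omega-cover must not have the whole space as a member. *)
have [AllT|AllT] := pselect (infinite_set [set k | W k = setT]).
  have [s hs sP] := infinite_enum AllT.
  exists s => // k x; have : [set: X] x by [].
  by rewrite -(sP k).
have /contrapT/finite_natP[K KP] := AllT.
have WT k : K <= k -> W k <> setT.
  by move=> Kk /KP; rewrite ltnNge Kk.
pose U := W @` [set k | K <= k].
have Uomega : omega_cover U.
  split; first by move=> [k Kk /WT]; exact.
  move=> D Dfin.
  suff /Finf/infinite_natP/(_ K)[k Kk kD] :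
      F [set k | forall x, D x -> quot h [set i | V i x] k].
    by exists (W k); [exists k|move=> x; apply: kD].
  have /finite_fsetP[E DE] := Dfin.
  have FF : Filter F by apply: filter_filter.
  apply: filterS (filter_bigI (D := E) FF (fun x _ => Fx x)) => k kE x.
  by rewrite DE; exact: kE.
have UO : COmega X U.
  split; last by move=> _ [k _ <-].
  split=> //; split.
  - exact: (sub_countable (card_image_le W _) (countableP _)).
  - by move=> _ [k _ <-]; case: (Wc k).
  apply/seteqP; split=> // x _; have [A UA xA] := Uomega.2 [set x] (finite_set1 x).
  by exists A => //; apply: xA.
have [A1 [A2 [A12 A12d _ [L1 L1A [[_ L1l] _]] [L2 L2A [[_ L2l] _]]]]] := splitting U UO.
(* Different [k] may give the same set [W k], but infinitely many members
   need infinitely many [k]. *)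
have hits (A L : set (set X)) x : large L -> L `<=` A -> A `<=` U ->
    infinite_set (quot h [set i | V i x] `&` [set k | A (W k)]).
  move=> Ll LA AU fin; apply: (Ll x).
  apply: sub_finite_set (finite_image W fin) => B [LB Bx].
  have [k Kk WkB] := AU _ (LA _ LB).
  have kx : W k x by rewrite WkB.
  by exists k => //; split; [exact: kx|rewrite /= WkB; exact: LA].
have A1U : A1 `<=` U by move=> A ?; rewrite -A12; left.
have A2U : A2 `<=` U by move=> A ?; rewrite -A12; right.
have [FA|FA] := in_ultra_setVsetC [set k | A1 (W k)] Fultra.
  have [x xA] := Fbase _ FA; apply: False_ind; apply: (hits A2 L2 x) => //.
  apply: sub_finite_set xA => k [kx A2k]; split=> // A1k.
  by suff : (A1 `&` A2) (W k) by rewrite A12d.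
have [x xA] := Fbase _ FA; apply: False_ind; apply: (hits A1 L1 x) => //.
by apply: sub_finite_set xA => k [kx A1k]; split.
Qed.

(** Each infinite set in the semifilter generated by the traces almost contains
    a trace, and this persists in the quotient ([Sbase]).  The quotient of a
    trace is the trace of the sequence of block unions [W], so the Menger
    property, applied to [W], excludes the full quotient, and the splitting
    property leaves the ultrafilter quotient only when infinitely many of these
    unions are the whole space. *)
Lemma trichotomy_meets_blocks V : semifilter_trichotomy ->
  Sfin (Open X) (Open X) -> Splitting (COmega X) (CLambda X) ->
  (forall i, clopen (V i)) -> (forall x, infinite_set [set i | V i x]) ->
  meets_blocks V.
Proof.
move=> trichotomy menger splitting Vc Vinf.
(* A semifilter is nonempty, which requires a point. *)
have [[x0 _]|X0] := pselect ([set: X] !=set0); last first.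
  exists id => // x; exfalso; apply: X0; by exists x.
pose S := [set b | infinite_set b /\
  exists x, almost_subset [set i | V i x] b].
have Sx x : S [set i | V i x].
  by split=> //; exists x; rewrite /almost_subset setDv.
have Ssemi : semifilter S.
  split; [by exists [set i | V i x0] | by move=> a [] |].
  move=> a b [_ [x xa]] binf ab; split=> //; exists x.
  apply: (sub_finite_set _ (_ : finite_set (([set i | V i x] `\` a) `|` (a `\` b)))).
    move=> i [ix nb]; case: (pselect (a i)) => ai; [by right|by left].
  by rewrite finite_setU.
have [h hh hS] := trichotomy S Ssemi.
have Sbase A : (quot h @` S) A ->
    exists x, almost_subset (quot h [set i | V i x]) A.
  by move=> [b [_ [x xb]] <-]; exists x; apply: quot_almost_subset.
case: hS => [frechetS|ultraS|allS].
- exists h => // x; have : (quot h @` S) (quot h [set i | V i x]).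
    exact: imageP.
  by rewrite frechetS.
- have [|s hs sP] := Splitting_ultrafilter_full_blocks splitting Vc hh ultraS _ Sbase.
    by move=> x; apply: imageP.
  exists (h \o s); first by move=> m n /hs /hh.
  by move=> x; rewrite quot_coarsen // setCT.
pose W k := [set x | quot h [set i | V i x] k].
have Wo k : open (W k).
  rewrite (_ : W k = \bigcup_(i in [set i | h k <= i < h k.+1]) V i).
    by apply: bigcup_open => i _; case: (Vc i).
  by apply/seteqP; split=> x [i]; [case=> ? ?|move=> ? ?]; exists i.
have Winf x : infinite_set [set k | W k x].
  suff : [set a | infinite_set a] (quot h [set i | V i x]) by [].
  by rewrite -allS; apply: imageP.
have [c cinf cP] := menger_not_dominated menger Wo Winf.
have [|x /cP] := Sbase c; first by rewrite allS.
by [].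
Qed.

(** * Coding covers by clopen sequences *)

Definition clopen_fibres (phi : X -> nat) : Prop :=
  forall m, clopen [set x | phi x = m].

Lemma clopen_fibres_addS (phi psi : X -> nat) :
  clopen_fibres phi -> clopen_fibres psi ->
  clopen_fibres (fun x => (phi x + psi x).+1).
Proof.
move=> phic psic m.
rewrite (_ : mkset _ = \bigcup_(i in `I_m)
    ([set x | phi x = i] `&` [set x | psi x = m.-1 - i])).
  by apply: clopen_bigcup => // i _; apply: clopenI.
apply/seteqP; split=> x /=.
  by move=> <-; exists (phi x) => /=; [|split=> //]; lia.
by move=> [i /= im [/= phix psix]]; lia.
Qed.

Lemma clopen_fibres_gapped_sums (f : nat -> X -> nat) :
  (forall n, clopen_fibres (f n)) ->
  forall n, clopen_fibres (fun x => gapped_sums (f^~ x) n).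
Proof.
by move=> fc; elim=> [|n IH] /=; [exact: fc|exact: clopen_fibres_addS].
Qed.

Lemma first_index_clopen_fibres (C : nat -> set X) :
  (forall i, clopen (C i)) -> (forall x, exists i, C i x) ->
  exists2 phi : X -> nat, clopen_fibres phi & forall x, C (phi x) x.
Proof.
move=> Cc Ccov.
have /choice[phi phiP] : forall x, exists i, C i x /\ forall j, C j x -> i <= j.
  move=> x; have ex : exists i, `[< C i x >].
    by have [i Cix] := Ccov x; exists i; apply/asboolP.
  case: (ex_minnP ex) => i /asboolP Cix imin.
  by exists i; split=> // j Cjx; apply: imin; apply/asboolP.
exists phi => [m|x]; last by case: (phiP x).
rewrite (_ : mkset _ = C m `&` ~` \bigcup_(j in `I_m) C j).
  apply: clopenI => //; apply: (clopenC set0).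
  exact: clopen_bigcup.
apply/seteqP; split=> x /=.
  move=> <-; split; first by case: (phiP x).
  by move=> [j /= jphi /((phiP x).2 j)]; lia.
move=> [Cmx nC]; have [Cphi phimin] := phiP x.
apply/eqP; rewrite eqn_leq phimin //= leqNgt; apply/negP => phim.
by apply: nC; exists (phi x).
Qed.

(** [f n x] is the first index at which the refinement [C n] catches [x], and
    [V] is chosen so that the trace of [x] is the range of a strictly increasing
    function above [f^~ x].  This range meets almost all blocks
    of [h], which bounds [f n x] for almost all [n] in terms of [h] only, so a
    finite part of the [n]th cover is enough at [n]. *)
Lemma refining_ufin_Gamma :
  (forall U, Open X U -> exists C : nat -> set X,
    [/\ forall i, clopen (C i), forall x, exists i, C i x
      & forall i, C i !=set0 -> exists2 A, U A & C i `<=` A]) ->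
  (forall V : nat -> set X, (forall i, clopen (V i)) ->
    (forall x, infinite_set [set i | V i x]) -> meets_blocks V) ->
  Ufin (Open X) (Gamma X).
Proof.
move=> refine blocks U UP.
have /choice[C CP] := fun n => refine (U n) (UP n).1.
have /choice[f fP] : forall n, exists phi : X -> nat,
    clopen_fibres phi /\ forall x, C n (phi x) x.
  move=> n; have [Cc Ccov _] := CP n.
  by have [phi ? ?] := first_index_clopen_fibres Cc Ccov; exists phi.
pose g n x := gapped_sums (f^~ x) n.
have gc n : clopen_fibres (g n).
  by apply: clopen_fibres_gapped_sums => k; case: (fP k).
have ghom x : {homo g^~ x : m n / (m < n)%N} := @gapped_sums_increasing _.
pose V m := [set x | range (g^~ x) m].
have Vc m : clopen (V m).
  rewrite (_ : V m = \bigcup_(n in `I_m.+1) [set x | g n x = m]).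
    by apply: clopen_bigcup => // n _; apply: gc.
  apply/seteqP; split=> x [n].
    move=> _ <-; exists n => //=; rewrite ltnS; exact: increasing_ge (ghom x) n.
  by move=> _ gn; exists n.
have Vinf x : infinite_set [set m | V m x].
  apply/infinite_natP => N; exists (g N x); first exact: increasing_ge (ghom x) N.
  by exists N.
have [h hh hP] := blocks V Vc Vinf.
have /choice[A AP] : forall p : nat * nat, exists A,
    C p.1 p.2 !=set0 -> U p.1 A /\ C p.1 p.2 `<=` A.
  move=> [n i] /=; have [_ _ CU] := CP n.
  by have [/CU[A UA CA]|C0] := pselect (C n i !=set0); [exists A|exists set0].
pose F n := [set A (n, i) | i in [set i | i < h n.*2.+1 /\ C n i !=set0]].
have FU n : F n `<=` U n.
  by move=> _ [i [_ Ci0] <-]; exact: (AP (n, i) Ci0).1.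
have Ffin n : finite_set (F n).
  apply: finite_image; apply/finite_natP; exists (h n.*2.+1) => i [ih _]; exact: ih.
exists F => //.
set G := (fun n => _).
have Gx x : exists N, forall n, N <= n -> G n x.
  have [N NP] := quot_range_bound hh (ghom x) (hP x).
  exists N => n Nn; have Cx := (fP n).2 x.
  have Cn0 : C n (f n x) !=set0 by exists x.
  exists (A (n, f n x)); last exact: (AP (n, f n x) Cn0).2.
  exists (f n x) => //; split=> //.
  exact: leq_ltn_trans (gapped_sums_ge (f^~ x) n) (NP n Nn).
(* No [G n] is the whole space.  This forces infinitely many values: with
   finitely many, a point outside each value would be in [G M] for one
   large [M], including the point chosen outside [G M]. *)
have GT n : G n <> setT.
  by move=> GT; apply: (UP n).2; exists (F n); split.
have Gcofin x : finite_set [set B | range G B /\ ~ B x].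
  have [N NP] := Gx x.
  apply: sub_finite_set (finite_image G (finite_II N)) => _ [[n _ <-] nGn].
  by exists n => //=; rewrite ltnNge; apply/negP => /NP.
split; last first.
  split=> // Gfin.
  have /choice[N NP] : forall B, exists N, range G B ->
      exists2 y, ~ B y & forall n, N <= n -> G n y.
    move=> B; have [[n _ <-]|nB] := pselect (range G B); last by exists 0 => /nB.
    have /existsNP[y nGy] : ~ forall y, G n y.
      by move=> Gn; apply: (GT n); apply/seteqP; split=> // z _; exact: Gn.
    by have [N NP] := Gx y; exists N => _; exists y.
  have /finite_natP[M MP] := finite_image N Gfin.
  have GM : range G (G M) by exists M.
  have [y nGy Gy] := NP _ GM; apply/nGy/Gy/ltnW/MP.
  exact: imageP.
split.
- exact: (sub_countable (card_image_le G _) (countableP _)).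
- move=> _ [n _ <-]; apply: bigcup_open => B /FU.
  by have [_ Uo _] := (UP n).1; apply: Uo.
apply/seteqP; split=> // x _; have [N NP] := Gx x.
by exists (G N); [exists N|apply: NP].
Qed.

(** This is the Lindelof argument: for each ball with a centre in the countable
    dense set and a radius [1/n.+1], choose one clopen set that contains the ball
    and is inside a member of the cover, if there is one.  Points of the dense
    set are numbered by an injection, and each index codes a ball. *)
Lemma clopen_countable_refinement (R : realType) (U : set (set X)) :
  separable X -> clopen_based X -> metrizable X R ->
  U `<=` @open X -> covers U ->
  exists C : nat -> set X,
    [/\ forall i, clopen (C i), forall x, exists i, C i x
      & forall i, C i !=set0 -> exists2 A, U A & C i `<=` A].
Proof.
move=> [D /countable_injP[f finj] Ddense] [_ clopenB] [d [d0 dC dD dnbhs]] Uo Ucov.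
pose r n : R := (n.+1%:R^-1)%R.
pose ball q n := [set y | (d q y < r n)%R].
pose fits m C := exists q n, [/\ D q, m = choice.pickle (f q, n), ball q n `<=` C,
  clopen C & exists2 A, U A & C `<=` A].
have /choice[C CP] : forall m, exists C, ~ (exists C, fits m C) /\ C = set0 \/ fits m C.
  move=> m; have [[C mC]|nC] := pselect (exists C, fits m C).
    by exists C; right.
  by exists set0; left.
exists C; split.
- move=> m; have [[_ ->]|[q [n []]] //] := CP m; exact: clopen0.
- move=> x; have : [set: X] x by [].
  rewrite -Ucov => -[A UA Ax].
  have Anbhs : nbhs x A by apply: open_nbhs_nbhs; split=> //; apply: Uo.
  have [B [Bc Bx] BA] := clopenB x A Anbhs.
  have /dnbhs[e e0 eB] : nbhs x B by apply: open_nbhs_nbhs; split=> //; case: Bc.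
  have [n ne] : exists n, (r n + r n <= e)%R.
    have [|n] := @ltr_add_invr R 0%R (e / 2)%R; first by rewrite divr_gt0 ?ltr0n.
    by rewrite add0r => /ltW rn; exists n; rewrite [leRHS]splitr lerD.
  have r0 : (0 < r n)%R by rewrite /r invr_gt0 ltr0n.
  have ballx : nbhs x (ball x n) by apply/dnbhs; exists (r n).
  have [|q [/interior_subset xq Dq]] := Ddense (ball x n)° _ (@open_interior _ _).
    by exists x.
  have fit : exists B, fits (choice.pickle (f q, n)) B.
    exists B, q, n; split=> //; last by exists A.
    move=> y qy; apply: eB => /=; apply: le_lt_trans (dD x q y) _.
    by apply: lt_le_trans ne; apply: ltrD.
  exists (choice.pickle (f q, n)).
  have [[]//|[q' [n' [Dq' pq ball' _ _]]]] := CP (choice.pickle (f q, n)).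
  have [fq nn] : (f q, n) = (f q', n') by apply: (pcan_inj choice.pickleK).
  apply: ball'; rewrite -nn -(finj q q') ?inE //= /ball /= dC.
  exact: xq.
move=> m; have [[_ ->] [x []]|[q [n [_ _ _ _ CU]]] _ //] := CP m.
Qed.

End Covers.

Theorem theorem3p4 (trichotomy : semifilter_trichotomy)
  (R : realType) (X : topologicalType)
  (Xsep : separable X) (X0dim : clopen_based X) (Xmet : metrizable X R) :
  (Ufin (Open X) (Gamma X) <->
     Sfin (Open X) (Open X) /\ Splitting (COmega X) (CLambda X)) /\
  (Ufin (Open X) (Gamma X) <->
     Sfin (Open X) (Open X) /\ Splitting (Omega X) (Lambda X)).
Proof.
have splitting_ufin : Sfin (Open X) (Open X) ->
    Splitting (COmega X) (CLambda X) -> Ufin (Open X) (Gamma X).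
  move=> menger splitting; apply: refining_ufin_Gamma.
    by move=> U [_ Uo Ucov]; apply: clopen_countable_refinement Xmet Uo Ucov.
  by move=> V; exact: trichotomy_meets_blocks.
split; split.
- move=> hurewicz; split; first exact: ufin_Gamma_Sfin.
  exact/Splitting_clopen/ufin_Gamma_Splitting.
- by case.
- move=> hurewicz; split; first exact: ufin_Gamma_Sfin.
  exact: ufin_Gamma_Splitting.
- by case=> menger /Splitting_clopen; exact: splitting_ufin.
Qed.
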